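(* Let $\pi,\tau\in\mathfrak{S}_m$ be in standard form. If $\pi_m-\pi_1>\tau_m-\tau_1$, then there is an integer $K$ such that $r^\pi_{1+k(m-1),k}<r^\tau_{1+k(m-1),k}$ for all $k\ge K$. In particular, $\pi$ and $\tau$ are not strongly c-Wilf equivalent.
   Context: The standardization $\operatorname{st}(w)$ of a word of distinct integers replaces its smallest entry by 1, the next smallest by 2, etc. For $\pi\in\mathfrak{S}_m$ and $\sigma\in\mathfrak{S}_n$, $\operatorname{Em}(\pi,\sigma)=\{i\in[n-m+1]:\operatorname{st}(\sigma_i\cdots\sigma_{i+m-1})=\pi\}$. The overlap set is $\mathcal{O}_\pi=\{i\in[m-1]:\operatorname{st}(\pi_{i+1}\cdots\pi_m)=\operatorname{st}(\pi_1\cdots\pi_{m-i})\}$. A $\pi$-cluster is a pair $(\sigma,S)$ with $\sigma\in\mathfrak{S}_n$ and $S=\{i_1<\dots<i_k\}\subseteq\operatorname{Em}(\pi,\sigma)$ such that $i_1=1$, $i_k=n-m+1$, and $i_{j+1}-i_j\in\mathcal{O}_\pi$ for all $j\in[k-1]$. The cluster number $r^\pi_{n,k}$ is the number of $\pi$-clusters $(\sigma,S)$ with $\sigma\in\mathfrak{S}_n$ and $|S|=k$. Letting $a^\pi_{n,k}$ be the number of $\sigma\in\mathfrak{S}_n$ with $|\operatorname{Em}(\pi,\sigma)|=k$, $\pi$ and $\tau$ are strongly c-Wilf equivalent if $a^\pi_{n,k}=a^\tau_{n,k}$ for all $n,k$. $\pi\in\mathfrak{S}_m$ is in standard form if $\pi_1<\pi_m$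 and $\pi_1+\pi_m\le m+1$. *)

(* Defs.v *)
(* Permutations are words (seq nat) over {1,...,m}; positions 1-based. *)
From mathcomp Require Import all_boot.
Set Implicit Arguments. Unset Strict Implicit. Unset Printing Implicit Defensive.

Definition is_perm (m : nat) (p : seq nat) : bool := perm_eq p (iota 1 m).

Definition perms (n : nat) : seq (seq nat) := permutations (iota 1 n).

Definition st (w : seq nat) : seq nat :=
  [seq (count (fun y => y < x) w).+1 | x <- w].

Definition Em (pi sigma : seq nat) : seq nat :=
  [seq i <- iota 1 (size sigma + 1 - size pi)
     | st (take (size pi) (drop i.-1 sigma)) == pi].

Definition Ov (pi : seq nat) : seq nat :=
  [seq i <- iota 1 (size pi - 1)
     | st (drop i pi) == st (take (size pi - i) pi)].

(* (sigma, S) is a pi-cluster; S is given as a subset of {0,...,n} and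
   listed in increasing order. *)
Definition is_cluster (pi sigma : seq nat) (n : nat) (S : {set 'I_n.+1}) : bool :=
  let s := [seq val i | i <- enum S] in
  [&& sorted ltn s, all (fun i => i \in Em pi sigma) s &
   if s is x :: t then
     [&& x == 1, last x t == size sigma + 1 - size pi &
         path (fun a b => (b - a) \in Ov pi) x t]
   else false].

Definition r (pi : seq nat) (n k : nat) : nat :=
  \sum_(sigma <- perms n)
     #|[set S : {set 'I_n.+1} | is_cluster pi sigma S && (#|S| == k)]|.

Definition a (pi : seq nat) (n k : nat) : nat :=
  count (fun sigma => size (Em pi sigma) == k) (perms n).

Definition strongly_cWilf (pi tau : seq nat) : Prop :=
  forall n k, a pi n k = a tau n k.

Definition standard_form (m : nat) (pi : seq nat) : bool :=
  (nth 0 pi 0 < nth 0 pi m.-1) && (nth 0 pi 0 + nth 0 pi m.-1 <= m + 1).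

(* Main.v *)
Require Import Defs.
From mathcomp Require Import all_boot all_algebra perm zify.
Set Implicit Arguments. Unset Strict Implicit. Unset Printing Implicit Defensive.
Import GRing.Theory.

(** Write D = m - 1. A cluster of length 1 + kD with k marks has all its gaps
    equal to D, so the cluster number counts the linear extensions of k chains
    of m elements in which the element of rank pi_m of each chain is glued to
    the element of rank pi_1 of the next. With d = pi_m - pi_1, this poset is a
    spine of kd + 1 elements plus k(D - d) further elements: the values of the
    latter determine the linear extension, so there are at most
    (2 + kD)^(k(D - d)) of them; placing all spine elements consecutively, and
    permuting freely among the chains the other elements of the same rank,
    gives at least k!^(D - d). Since k^k <= 4^k k!, a smaller d wins for large k.

    For the second claim, the polynomial counting permutations with a marked
    set of occurrences is determined by the occurrence distribution. Cutting at
    the first gap not covered by a marked window gives a recursion which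
    determines from it the polynomial of the marked permutations without such a
    gap, and the coefficient of X^k in size 1 + kD of the latter is the cluster
    number. *)

(** * Standardization of words and its inverse on a given set of letters *)

Lemma size_st w : size (st w) = size w.
Proof. exact: size_map. Qed.

Lemma st_map f w : {in w &, {mono f : x y / x < y}} -> st (map f w) = st w.
Proof.
move=> fm; rewrite /st -map_comp; apply/eq_in_map => x xw /=.
rewrite count_map; congr S; apply/eq_in_count => y yw; exact: fm.
Qed.

Definition rank (w : seq nat) (x : nat) := (count (fun y => y < x) w).+1.

Lemma rank_mono w : {in w &, {mono rank w : x y / x < y}}.
Proof.
have le x y : x <= y -> rank w x <= rank w y.
  by move=> xy; rewrite ltnS; apply: sub_count => z /= zx; apply: leq_trans xy.
move=> x y xw yw; case: (ltnP x y) => [xy|/le]; last by rewrite leqNgt => /negbTE.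
rewrite /rank ltnS.
have -> : count (fun z => z < y) w =
    count (fun z => z < x) w + count (fun z => x <= z < y) w.
  by elim: (w) => //= z t ->; lia.
by rewrite -addn1 leq_add2l -has_count; apply/hasP; exists x; rewrite ?leqnn.
Qed.

Lemma rank_inj w : {in w &, injective (rank w)}.
Proof.
move=> x y xw yw e; have := rank_mono xw yw; have := rank_mono yw xw.
by rewrite e !ltnn; case: ltngtP.
Qed.

Lemma mem_perms n s : (s \in perms n) = perm_eq s (iota 1 n).
Proof. exact: mem_permutations. Qed.

Lemma perms_size n s : s \in perms n -> size s = n.
Proof. by rewrite mem_perms => /perm_size; rewrite size_iota. Qed.

Lemma perms_uniqE n s : s \in perms n -> uniq s.
Proof. by rewrite mem_perms => /perm_uniq ->; exact: iota_uniq. Qed.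

Lemma mem_perms_uniq n (s : seq nat) :
  uniq s -> size s = n -> {in s, forall x, 0 < x <= n} -> s \in perms n.
Proof.
move=> us sn sP; rewrite mem_perms; apply: uniq_perm => //; first exact: iota_uniq.
have sub : {subset s <= iota 1 n}.
  by move=> x xs; rewrite mem_iota add1n ltnS; exact: sP.
by case: (uniq_min_size us sub); rewrite ?size_iota ?sn.
Qed.

Lemma st_perms w : uniq w -> st w \in perms (size w).
Proof.
move=> uw; apply: mem_perms_uniq; rewrite ?size_st //.
  by rewrite map_inj_in_uniq //; exact: rank_inj.
move=> _ /mapP [x xw ->] /=; rewrite -size_filter.
rewrite -[in X in _ < X](count_predC (fun y => y < x)) size_filter -addn1 leq_add2l.
by rewrite -has_count; apply/hasP; exists x; rewrite //= ltnn.
Qed.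

Lemma st_id n s : s \in perms n -> st s = s.
Proof.
rewrite mem_perms => sp; rewrite -[RHS]map_id; apply/eq_in_map => x.
rewrite (perm_mem sp) mem_iota => xn.
have -> : count (fun y => y < x) s = count (fun y => y < x) (iota 1 n).
  by move/seq.permP: sp; apply.
(* Cutting [iota 1 n] just before [x]: exactly the first [x - 1] letters are smaller than [x]. *)
have -> : n = x.-1 + (n - x.-1) by lia.
rewrite iotaD count_cat (_ : count _ (iota 1 x.-1) = x.-1).
  rewrite (_ : count _ _ = 0); first lia.
  apply/eqP; rewrite -leqn0 leqNgt -has_count; apply/hasPn => y.
  rewrite mem_iota; lia.
rewrite -[RHS](size_iota 1); apply/eqP; rewrite -all_count; apply/allP => y.
rewrite mem_iota; lia.
Qed.

(** Once the multiset of letters is fixed, a letter is recovered from its rank. *)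
Lemma perm_st_inj u v : perm_eq u v -> st u = st v -> u = v.
Proof.
move=> puv e; have suv := perm_size puv.
apply: (@eq_from_nth _ 0) => // i iu; apply: (@rank_inj u); rewrite ?mem_nth //.
  by rewrite (perm_mem puv) mem_nth -?suv.
have := congr1 (nth 0 ^~ i) e; rewrite /= /st !(nth_map 0) -?suv // -/(rank u _) => ->.
by rewrite /rank; congr S; apply/esym/seq.permP.
Qed.

(* The rearrangement of the letters of [w] whose standardization is [p]. *)
Definition unst (w p : seq nat) := [seq nth 0 (sort leq w) x.-1 | x <- p].

Lemma perm_unst (w p : seq nat) : p \in perms (size w) -> perm_eq (unst w p) w.
Proof.
rewrite mem_perms => pp; rewrite perm_sym -(perm_sort leq w) perm_sym.
apply: (perm_trans (perm_map _ pp)); rewrite (iotaDl 1 0) -map_comp.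
have <- : size (sort leq w) = size w by rewrite size_sort.
rewrite (eq_map (_ : _ =1 nth 0 (sort leq w))) //.
by rewrite -/(mkseq _ _) mkseq_nth.
Qed.

Lemma st_unst (w p : seq nat) : uniq w -> p \in perms (size w) -> st (unst w p) = p.
Proof.
move=> uw pp; rewrite st_map; first exact: st_id pp.
have sw : sorted ltn (sort leq w).
  by rewrite ltn_sorted_uniq_leq sort_uniq uw sort_sorted //; exact: leq_total.
have H (x y : nat) : x \in p -> y \in p -> x < y ->
    nth 0 (sort leq w) x.-1 < nth 0 (sort leq w) y.-1.
  move: pp; rewrite mem_perms => /perm_mem E; rewrite !E !mem_iota => hx hy xy.
  apply: (sorted_ltn_nth ltn_trans) => //; rewrite ?inE ?size_sort; lia.
move=> x y xp yp; case: (ltngtP x y) => [xy|yx|->]; last by rewrite ltnn.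
  by rewrite H.
by apply/negbTE; rewrite -leqNgt ltnW // H.
Qed.

Lemma eq_perm_unst u v p : p \in perms (size u) -> p \in perms (size v) ->
  unst u p = unst v p -> perm_eq u v.
Proof.
move=> pu pv e; apply: perm_trans (perm_unst pv).
by rewrite -e perm_sym perm_unst.
Qed.

(** * Cutting a permutation into two blocks with independent patterns *)

Definition fiber l (p q s : seq nat) :=
  (st (take l s) == p) && (st (drop l s) == q).

(** Rearranging the two blocks to the patterns [p'] and [q'] keeps their letter sets, and these
    together with [p] and [q] determine [s]; so the map [f] is injective. By symmetry all fibers
    have equal size. *)
Lemma count_fiber_le n l (p q p' q' : seq nat) : l <= n ->
  p' \in perms l -> q' \in perms (n - l) ->
  count (fiber l p q) (perms n) <= count (fiber l p' q') (perms n).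
Proof.
move=> ln hp hq; pose f s := unst (take l s) p' ++ unst (drop l s) q'.
have sz s : s \in perms n -> size (take l s) = l /\ size (drop l s) = n - l.
  by move=> /perms_size sn; rewrite size_takel ?size_drop sn.
rewrite -!size_filter -(size_map f); apply: uniq_leq_size.
  rewrite map_inj_in_uniq ?filter_uniq ?permutations_uniq // => s t.
  rewrite !mem_filter => /andP [/andP [/eqP s1 /eqP s2] sP] /andP [/andP [/eqP t1 /eqP t2] tP].
  have [sz1 sz2] := sz _ sP; have [tz1 tz2] := sz _ tP.
  move/eqP; rewrite eqseq_cat ?size_map // => /andP [/eqP e1 /eqP e2].
  rewrite -(cat_take_drop l s) -(cat_take_drop l t); congr (_ ++ _).
    by apply: perm_st_inj; [apply: eq_perm_unst e1; rewrite ?sz1 ?tz1 | rewrite s1].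
  by apply: perm_st_inj; [apply: eq_perm_unst e2; rewrite ?sz2 ?tz2 | rewrite s2].
move=> _ /mapP [s + ->]; rewrite !mem_filter => /andP [_ sP].
have [sz1 sz2] := sz _ sP; have us := perms_uniqE sP.
have szu : size (unst (take l s) p') = l by rewrite size_map (perms_size hp).
rewrite /fiber /f -{1 3}szu take_size_cat // drop_size_cat //.
rewrite !st_unst ?take_uniq ?drop_uniq ?sz1 ?sz2 // !eqxx /=.
rewrite mem_perms; move: sP; rewrite mem_perms; apply: perm_trans.
by rewrite -{3}(cat_take_drop l s) perm_cat ?perm_unst ?sz1 ?sz2.
Qed.

(** This is the binomial coefficient ['C(n, l)], represented by the fiber over two identity
    patterns. *)
Definition fiber_size n l := count (fiber l (iota 1 l) (iota 1 (n - l))) (perms n).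

Lemma iota_perms n : iota 1 n \in perms n.
Proof. by rewrite mem_perms. Qed.

Lemma count_fiber n l p q : l <= n -> p \in perms l -> q \in perms (n - l) ->
  count (fiber l p q) (perms n) = fiber_size n l.
Proof.
by move=> ln hp hq; apply/eqP; rewrite eqn_leq !count_fiber_le ?iota_perms.
Qed.

Lemma sum_eq_mem (T : eqType) (t : seq T) (P : pred T) x : uniq t -> x \in t ->
  \sum_(y <- t) (x == y) * P y = P x.
Proof.
move=> ut xt; rewrite (bigD1_seq x) //= eqxx mul1n big1 ?addn0 // => y.
by rewrite eq_sym => /negbTE ->.
Qed.

Lemma countE (T : Type) (t : seq T) (P : pred T) : count P t = \sum_(x <- t) P x.
Proof. by rewrite -sum1_count big_mkcond. Qed.

Lemma count_split n l (P Q : pred (seq nat)) : l <= n ->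
  count (fun s => P (st (take l s)) && Q (st (drop l s))) (perms n) =
  fiber_size n l * (count P (perms l) * count Q (perms (n - l))).
Proof.
move=> ln; rewrite !countE big_distrlr big_distrr /=.
(* The permutations are sorted by the patterns of their two blocks; only the pair of actual patterns
   contributes. *)
transitivity (\sum_(s <- perms n) \sum_(p <- perms l) \sum_(q <- perms (n - l))
     fiber l p q s * (P p * Q q)).
  rewrite !big_seq; apply: eq_bigr => s sP.
  have us := perms_uniqE sP; have sn := perms_size sP.
  have h1 : st (take l s) \in perms l.
    have {2}-> : l = size (take l s) by rewrite size_takel ?sn.
    by rewrite st_perms ?take_uniq.
  have h2 : st (drop l s) \in perms (n - l).
    have -> : n - l = size (drop l s) by rewrite size_drop sn.
    by rewrite st_perms ?drop_uniq.
  rewrite -mulnb -(sum_eq_mem P (permutations_uniq _) h1).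
  rewrite -(sum_eq_mem Q (permutations_uniq _) h2) big_distrlr /=.
  apply: eq_bigr => p _; apply: eq_bigr => q _; rewrite /fiber -mulnb; lia.
rewrite exchange_big /= big_seq [RHS]big_seq; apply: eq_bigr => p hp.
rewrite exchange_big /= big_distrr /= big_seq [RHS]big_seq; apply: eq_bigr => q hq.
by rewrite -big_distrl /= -countE count_fiber.
Qed.

(** * Marked occurrences and the first gap not covered by a marked window *)

Definition occ (p s : seq nat) := st (take (size p) s) == p.

(** The implication leaves unmarked positions free, so that [b] selects an arbitrary subset of the
    occurrences. *)
Fixpoint marked (p s : seq nat) (b : bitseq) :=
  if b is x :: b' then (x ==> occ p s) && marked p (behead s) b' else true.

(* Reading [b] from left to right, [c] is the number of gaps between
   neighbouring letters still covered by the marked windows, a mark covering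
   the next [D] gaps; [linked] says that the first uncovered gap is the end of
   [b]. *)
Fixpoint linked (D c : nat) (b : bitseq) :=
  if b is x :: b' then
    if (if x then D else c) is c'.+1 then linked D c' b' else nilp b'
  else false.

Lemma occ_size p s : occ p s -> size p <= size s.
Proof. by move=> /eqP <-; rewrite size_st size_take_min geq_minr. Qed.

Lemma marked_cat p s b1 b2 :
  marked p s (b1 ++ b2) = marked p s b1 && marked p (drop (size b1) s) b2.
Proof.
elim: b1 s => [|x b IH] s /=; first by rewrite drop0.
by rewrite IH andbA; case: s => //=; case: b {IH}.
Qed.

Lemma marked_map f p s b : {in s &, {mono f : x y / x < y}} ->
  marked p (map f s) b = marked p s b.
Proof.
elim: b s => [|x b IH] s fm //=; congr (_ && _).
  rewrite /occ -map_take st_map // => y z /mem_take ys /mem_take; exact: fm.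
rewrite behead_map IH // => y z /mem_behead ys /mem_behead; exact: fm.
Qed.

Lemma marked_st p s b : marked p (st s) b = marked p s b.
Proof. exact/marked_map/rank_mono. Qed.

(** Under [c <= D] a mark can only prolong the coverage, so the [c] gaps covered at the start all
    lie inside [b]. *)
Lemma linked_size D c b : c <= D -> linked D c b -> c < size b.
Proof.
elim: b c => [|x b IH] c //= cD; case: x; last first.
  by case: c cD => // c cD /IH H; rewrite ltnS H // ltnW.
case: D IH cD => [|D] IH cD; first by move=> _; exact: leq_ltn_trans cD _.
by move=> /IH H; apply: leq_ltn_trans cD _; rewrite ltnS; apply: H.
Qed.

(** By [linked_size] at the counter reset by a mark, each marked window ends inside the mask; later
    letters do not matter. *)
Lemma marked_take D c p s b : size p = D.+1 -> c <= D -> linked D c b ->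
  marked p s b = marked p (take (size b) s) b.
Proof.
move=> pD; elim: b c s => [|x b IH] c s // cD lb.
have -> : marked p s (x :: b) = (x ==> occ p s) && marked p (behead s) b by [].
have -> : marked p (take (size (x :: b)) s) (x :: b) =
    (x ==> occ p (take (size b).+1 s)) && marked p (take (size b) (behead s)) b.
  by rewrite /=; congr (_ && marked _ _ _); case: s.
congr (_ && _).
  case: x lb => //= lb; rewrite /occ pD take_takel // ltnS.
  case: D {IH pD cD} lb => // D lb; exact: linked_size lb.
move: lb => /=; case: x => /=.
  case: D pD {cD} IH => [|D] pD IH lb; first by case: b lb {IH}.
  exact: (IH D).
by case: c cD => [|c] cD lb; [case: b lb {IH} | apply: (IH c) => //; exact: ltnW].
Qed.

(** At most one prefix stops at the first uncovered gap. One does, because every marked window fits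
    into [s], so that the coverage never outruns [b]. *)
Lemma sum_linked D c p s b : size p = D.+1 -> size s = size b -> c < size b ->
  marked p s b -> \sum_(1 <= l < (size b).+1) linked D c (take l b) = 1.
Proof.
move=> pD; elim: b c s => [|x b IH] c s //= sb cb /andP [xo mb].
rewrite big_ltn // big_add1 /= take0.
case E: (if x then D else c) => [|c'] /=.
  rewrite big_nat big1 // => l /andP [l0 lb]; case: b lb {IH sb cb mb} => /=.
    by case: l l0.
  by case: l l0.
rewrite add0n; apply: IH mb; rewrite ?size_behead ?sb //.
case: x xo E => /=; last by move=> _ E; rewrite E in cb.
by move=> /occ_size; rewrite pD sb => + E; rewrite E.
Qed.

Fixpoint masks n : seq bitseq :=
  if n is n'.+1 then map (cons true) (masks n') ++ map (cons false) (masks n')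
  else [:: [::]].

Lemma mem_masks n b : (b \in masks n) = (size b == n).
Proof.
elim: n b => [|n IH] [|x b] //=; rewrite mem_cat.
  by apply/norP; split; apply/mapP => -[].
rewrite eqSS -IH; apply/orP/idP => [[] /mapP [c cm [_ ->]] //|bm].
by case: x; [left | right]; apply: map_f.
Qed.

Lemma masks_uniq n : uniq (masks n).
Proof.
elim: n => //= n IH; rewrite cat_uniq !map_inj_uniq ?IH /= ?andbT => [|x y [] //|x y [] //].
by apply/hasPn => _ /mapP [b _ ->]; apply/mapP => -[].
Qed.

(** * Generating polynomials of marked permutations and their recursion *)

Local Open Scope ring_scope.

Lemma sum_masksD l n (G : bitseq -> {poly int}) :
  \sum_(b <- masks (l + n)) G b = \sum_(b1 <- masks l) \sum_(b2 <- masks n) G (b1 ++ b2).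
Proof.
elim: l G => [|l IH] G /=; first by rewrite big_seq1.
by rewrite !big_cat !big_map /= !IH.
Qed.

Definition num_marked (p : seq nat) (b : bitseq) : nat :=
  count (marked p ^~ b) (perms (size b)).

Definition weight (p : seq nat) (b : bitseq) : {poly int} :=
  'X^(count id b) *+ num_marked p b.

Definition marked_gf (p : seq nat) n : {poly int} := \sum_(b <- masks n) weight p b.

Definition linked_gf (p : seq nat) n : {poly int} :=
  \sum_(b <- masks n | linked (size p).-1 0 b) weight p b.

(** No window marked in [b1] crosses the cut, so the marks constrain the patterns of the two blocks
    separately. *)
Lemma num_marked_cat p b1 b2 : (0 < size p)%N -> linked (size p).-1 0 b1 ->
  num_marked p (b1 ++ b2) = (fiber_size (size b1 + size b2) (size b1) *
    (num_marked p b1 * num_marked p b2))%N.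
Proof.
move=> p0 lb; rewrite /num_marked size_cat.
have -> : size b2 = (size b1 + size b2 - size b1)%N by rewrite addKn.
rewrite subnKC ?leq_addr // -count_split ?leq_addr //.
apply: eq_count => s /=; rewrite marked_cat !marked_st; congr andb.
by rewrite (marked_take _ _ _ lb) // prednK.
Qed.

Lemma marked_gf_rec p n : (0 < size p)%N -> (0 < n)%N ->
  marked_gf p n = \sum_(1 <= l < n.+1)
    (linked_gf p l * marked_gf p (n - l)) *+ fiber_size n l.
Proof.
move=> p0 n0; set D := (size p).-1.
transitivity (\sum_(1 <= l < n.+1) \sum_(b <- masks n)
   weight p b *+ linked D 0 (take l b)).
  rewrite exchange_big /marked_gf big_seq [RHS]big_seq; apply: eq_bigr => b.
  rewrite mem_masks => /eqP bn; rewrite sumrMnr.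
  (* A mask realized by no permutation may have a window running past its end, so [sum_linked] does
     not apply; its weight is zero. *)
  case: (posnP (num_marked p b)) => [z|]; first by rewrite /weight z mulr0n mul0rn.
  rewrite -has_count => /hasP [s sP ms]; rewrite -bn.
  by rewrite (sum_linked _ (perms_size sP) _ ms) ?bn // prednK.
apply: eq_big_nat => l /andP [l0 ln].
rewrite -[in masks n](subnKC (ln : l <= n)%N) sum_masksD big_distrlr /= -sumrMnl.
rewrite [RHS]big_mkcond /= big_seq [RHS]big_seq; apply: eq_bigr => b1.
rewrite mem_masks => /eqP b1l; rewrite -/D.
have E b2 : take l (b1 ++ b2) = b1 by rewrite -b1l take_size_cat.
under eq_bigr => b2 _ do rewrite E.
case: ifP => lb; last by rewrite big1.
rewrite -sumrMnl big_seq [RHS]big_seq; apply: eq_bigr => b2.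
rewrite mem_masks => /eqP b2l; rewrite mulr1n /weight num_marked_cat // b1l b2l.
rewrite count_cat exprD subnKC // mulrnAl mulrnAr -!mulrnA.
by congr (_ *+ _); lia.
Qed.

(** Each occurrence is either left unmarked or marked, which gives a factor [1 + 'X]. *)
Lemma sum_marked p s n : \sum_(b <- masks n) 'X^(count id b) *+ marked p s b =
  (1 + 'X : {poly int}) ^+ count (fun i => occ p (drop i s)) (iota 0 n).
Proof.
elim: n s => [|n IH] s; first by rewrite /= big_seq1 expr0.
rewrite [masks _]/= big_cat !big_map.
rewrite [iota _ _]/= [count _ _]/= exprD drop0 (iotaDl 1 0) count_map.
have -> : count (preim (addn 1) (fun i => occ p (drop i s))) (iota 0 n) =
    count (fun i => occ p (drop i (behead s))) (iota 0 n).
  by apply: eq_count => i; rewrite /preim /= add1n -drop1 drop_drop addn1.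
rewrite -IH /=; case: (occ p s) => /=; last first.
  by rewrite expr0 mul1r big1 ?add0r.
rewrite expr1 mulrDl mul1r addrC; congr (_ + _).
by rewrite big_distrr; apply: eq_bigr => b _ /=; rewrite mulrnAr -exprS.
Qed.

Lemma size_Em p s : (0 < size p)%N ->
  size (Em p s) = count (fun i => occ p (drop i s)) (iota 0 (size s)).
Proof.
move=> p0; rewrite size_filter (iotaDl 1 0) count_map.
rewrite -[in iota 0 (size s)](@subnKC (size s + 1 - size p) (size s)); last by lia.
rewrite iotaD count_cat [X in _ = (_ + X)%N](_ : _ = 0%N) ?addn0; last first.
  apply/eqP; rewrite -leqn0 leqNgt -has_count; apply/hasPn => i.
  rewrite mem_iota => hi; apply/negP => /occ_size; rewrite size_drop; lia.
by apply: eq_count.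
Qed.

Lemma marked_gf_Em p n : (0 < size p)%N ->
  marked_gf p n = \sum_(s <- perms n) (1 + 'X) ^+ size (Em p s).
Proof.
move=> p0; transitivity (\sum_(s <- perms n) \sum_(b <- masks n)
   ('X : {poly int}) ^+ count id b *+ marked p s b).
  rewrite exchange_big /= /marked_gf big_seq [RHS]big_seq; apply: eq_bigr => b.
  rewrite mem_masks => /eqP bn; rewrite sumrMnr /weight /num_marked bn.
  by congr (_ *+ _); exact: countE.
rewrite big_seq [RHS]big_seq; apply: eq_bigr => s /perms_size sn.
by rewrite size_Em // sum_marked sn.
Qed.

Lemma marked_gf_eq p q n : (0 < size p)%N -> (0 < size q)%N ->
  strongly_cWilf p q -> marked_gf p n = marked_gf q n.
Proof.
move=> p0 q0 pq; rewrite !marked_gf_Em //.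
rewrite -(big_map (fun s => size (Em p s)) xpredT (fun i => (1 + 'X) ^+ i)).
rewrite -(big_map (fun s => size (Em q s)) xpredT (fun i => (1 + 'X) ^+ i)).
(* Strong equivalence says that the two multisets of occurrence counts coincide. *)
apply: perm_big; apply/allP => i _ /=; rewrite !count_map; apply/eqP.
exact: (pq n i).
Qed.

Lemma perms0 : perms 0 = [:: [::]].
Proof. by []. Qed.

Lemma marked_gf0 p : marked_gf p 0 = 1.
Proof. by rewrite /marked_gf big_seq1 /weight /num_marked perms0 /= expr0. Qed.

Lemma fiber_sizenn n : fiber_size n n = 1%N.
Proof.
rewrite /fiber_size subnn /= (_ : count _ _ = count_mem (iota 1 n) (perms n)).
  by rewrite count_uniq_mem ?permutations_uniq // iota_perms.
apply: eq_in_count => s sP; have sn := perms_size sP.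
by rewrite /fiber -{1 3}sn take_size drop_size (st_id sP) andbT.
Qed.

(** The term [l = n] of the recursion is [linked_gf p n] with coefficient 1, and all other terms
    agree by induction. *)
Lemma linked_gf_eq p q n : (0 < size p)%N -> (0 < size q)%N ->
  strongly_cWilf p q -> linked_gf p n = linked_gf q n.
Proof.
move=> p0 q0 pq; elim/ltn_ind: n => -[|n] IH.
  by rewrite /linked_gf !big_cons !big_nil.
have := marked_gf_eq n.+1 p0 q0 pq.
rewrite !marked_gf_rec // !(big_nat_recr n.+1) //= subnn !marked_gf0 !mulr1.
rewrite fiber_sizenn !mulr1n.
rewrite (eq_big_nat _ _ (F2 := fun l =>
   linked_gf q l * marked_gf q (n.+1 - l) *+ fiber_size n.+1 l)); first exact: addrI.
by move=> l /andP [l0 ln]; rewrite (marked_gf_eq _ p0 q0 pq) IH.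
Qed.

(** * The extremal mask and its coefficient *)

(** The leading [c] unmarked letters use up the initial coverage of [linked]; for [k > 0] the final
    [false] is the last letter of the last window. *)
Definition tight D c k : bitseq :=
  nseq c false ++ iter k (cat (true :: nseq D.-1 false)) [:: false].

(** A mark resets the coverage to [D], so it adds at most [D] letters. It adds exactly [D] only if
    the coverage was exhausted when it came, which fixes the position of every mark. *)
Lemma linked_tight D c b : (0 < D)%N -> linked D c b ->
  (size b <= c + count id b * D + 1)%N /\
  (size b = (c + count id b * D + 1)%N -> b = tight D c (count id b)).
Proof.
move=> D0; elim: b c => [|x b IH] c //=; case: x => /=.
  case: D D0 IH => // D _ IH /IH [h1 h2]; split; first lia.
  rewrite add1n => e; have c0 : c = 0%N by lia.
  by rewrite c0 /tight /= {1}h2 //; lia.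
case: c => [|c].
  by move=> /nilP -> /=; split.
by move=> /IH [h1 h2]; split; [lia | rewrite add0n => e; rewrite {1}h2 //; lia].
Qed.

Lemma linked_tightb D c k : (0 < D)%N -> linked D c (tight D c k).
Proof.
move=> D0; elim: k c => [|k IH] c; rewrite /tight.
  by elim: c.
by elim: c => //=; case: D D0 IH => // D _ IH; apply: IH.
Qed.

Lemma size_tight D c k : (0 < D)%N -> size (tight D c k) = (c + k * D + 1)%N.
Proof.
move=> D0; rewrite size_cat size_nseq -addnA; congr addn.
elim: k => //= k IH; rewrite size_cat size_nseq IH mulSn; lia.
Qed.

Lemma count_tight D c k : count id (tight D c k) = k.
Proof.
rewrite count_cat count_nseq add0n.
by elim: k => //= k IH; rewrite count_cat count_nseq IH.
Qed.

Lemma coef_linked_gf p k : (1 < size p)%N ->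
  (linked_gf p (1 + k * (size p - 1)))`_k =
  (num_marked p (tight (size p - 1) 0 k))%:R.
Proof.
move=> p1; rewrite coef_sum -subn1; set D := (size p - 1)%N.
have D0 : (0 < D)%N by rewrite subn_gt0.
have sz : size (tight D 0 k) = (1 + k * D)%N by rewrite size_tight // addnC.
move: (1 + k * D)%N sz => n sn.
have tm : tight D 0 k \in masks n by rewrite mem_masks sn.
rewrite big_mkcond (bigD1_seq _ tm (masks_uniq _)) /= linked_tightb //.
rewrite /weight coefMn coefXn count_tight eqxx big_seq_cond big1 ?addr0 // => b.
rewrite mem_masks => /andP [/eqP bn bt]; case: ifP => // lb.
rewrite coefMn coefXn; case: eqP => [e|_]; last by rewrite mul0rn.
have [_ h] := linked_tight D0 lb; case/eqP: bt.
by rewrite {1}h -?e // bn -sn size_tight.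
Qed.
Local Close Scope ring_scope.

Lemma strongly_cWilf_tight p q k : 1 < size p -> size p = size q ->
  strongly_cWilf p q ->
  num_marked p (tight (size p - 1) 0 k) = num_marked q (tight (size p - 1) 0 k).
Proof.
move=> p1 pq w; have := linked_gf_eq (1 + k * (size p - 1)) (ltnW p1) _ w.
rewrite -pq => /(_ (ltnW p1)) /(congr1 (fun r : {poly int} => r`_k)%R).
by rewrite {2}pq !coef_linked_gf -?pq // => /eqP; rewrite Num.Theory.eqr_nat => /eqP.
Qed.

(** * Cluster numbers as counts for the extremal mask *)

Lemma marked_tightP D p s k : 0 < D ->
  reflect (forall j, j < k -> occ p (drop (j * D) s)) (marked p s (tight D 0 k)).
Proof.
move=> D0; have -> : marked p s (tight D 0 k) =
    all (fun j => occ p (drop (j * D) s)) (iota 0 k).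
  elim: k s => [|k IH] s; first by rewrite /tight /=.
  have -> : tight D 0 k.+1 = (true :: nseq D.-1 false) ++ tight D 0 k by [].
  rewrite marked_cat IH /= size_nseq prednK // mul0n drop0 (iotaDl 1 0) all_map.
  have -> : marked p (behead s) (nseq D.-1 false).
    by elim: (D.-1) (behead s) => //= c IHc t; rewrite IHc.
  rewrite andbT; congr andb; apply: eq_all => j /=.
  by rewrite drop_drop mulSn addnC.
apply: (iffP allP) => H j; first by move=> jk; apply: H; rewrite mem_iota.
by rewrite mem_iota => /H.
Qed.

Lemma path_max_step D x t : path (fun a b => a < b <= a + D) x t ->
  last x t <= x + size t * D /\
  (last x t = x + size t * D -> t = [seq x + j * D | j <- iota 1 (size t)]).
Proof.
elim: t x => [|y t IH] x /=; first by rewrite addn0.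
move=> /andP [xy /IH [h1 h2]]; split; first by lia.
move=> e; have ey : y = x + D by lia.
rewrite h2; last by lia.
rewrite size_map size_iota (iotaDl 1 1) -map_comp mul1n -ey; congr cons.
by apply: eq_map => j /=; lia.
Qed.

Lemma st1 w : size w = 1 -> st w = [:: 1].
Proof. by case: w => [|x []] //= _; rewrite /st /= ltnn. Qed.

(** Overlaps in a single letter are always allowed. *)
Lemma max_Ov p : 1 < size p -> size p - 1 \in Ov p.
Proof.
move=> p1; rewrite mem_filter mem_iota subn_gt0 p1 add1n leqnn !andbT.
by rewrite !st1 ?size_drop ?size_takel //; lia.
Qed.

Lemma mem_Em p s i : 0 < size p ->
  (i.+1 \in Em p s) = occ p (drop i s).
Proof.
move=> p0; rewrite mem_filter mem_iota /= -/(occ p (drop i s)).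
apply/andP/idP => [[]//|o]; split=> //; move/occ_size: o; rewrite size_drop; lia.
Qed.

Lemma sorted_val_enum n (S : {set 'I_n}) : sorted ltn [seq val i | i <- enum S].
Proof.
have /subseq_sorted : subseq [seq val i | i <- enum S] (iota 0 n).
  by rewrite -val_enum_ord map_subseq // {1}/enum_mem -enumT filter_subseq.
by apply; [exact: ltn_trans | exact: iota_ltn_sorted].
Qed.

Lemma is_cluster_tight p s k (S : {set 'I_(1 + k * (size p - 1)).+1}) :
  1 < size p -> 0 < k -> size s = 1 + k * (size p - 1) ->
  is_cluster p s S && (#|S| == k) =
  (S == [set i | val i \in [seq 1 + j * (size p - 1) | j <- iota 0 k]])
  && marked p s (tight (size p - 1) 0 k).
Proof.
move=> p1 k0; move Dn : (size p - 1) S => D S sn.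
have D0 : 0 < D by lia.
set s0 := [seq _ | j <- _].
have s0E : s0 = 1 :: [seq 1 + j * D | j <- iota 1 k.-1].
  by rewrite /s0 -{1}(prednK k0).
have s0P : path (fun a b => a < b <= a + D) 1 [seq 1 + j * D | j <- iota 1 k.-1].
  apply/(pathP 0) => i; rewrite size_map size_iota => ik.
  rewrite -s0E /s0 !(nth_map 0) ?size_iota ?nth_iota //; lia.
have s0mem i : i \in s0 -> i < (1 + k * D).+1.
  move=> /mapP [j]; rewrite mem_iota => jk ->; nia.
have enum0 : [seq val i | i <- enum [set i : 'I_(1 + k * D).+1 | val i \in s0]] = s0.
  apply: (irr_sorted_eq ltn_trans ltnn) => [||i]; first exact: sorted_val_enum.
    by rewrite s0E /=; apply: sub_path s0P => x y /andP [].
  apply/mapP/idP => [[j + ->]|is0]; first by rewrite mem_enum inE.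
  by exists (Ordinal (s0mem _ is0)); rewrite ?mem_enum ?inE.
have markE : all (fun i => i \in Em p s) s0 = marked p s (tight D 0 k).
  apply/allP/(marked_tightP _ _ _ D0) => [H j jk|H i /mapP [j jk ->]].
    by rewrite -mem_Em ?H 1?ltnW // -add1n; apply: map_f; rewrite mem_iota.
  by move: jk; rewrite mem_iota add1n => jk; rewrite mem_Em ?H // ltnW.
have lastE : size s + 1 - size p = 1 + k.-1 * D by nia.
apply/andP/andP => [[/and3P [srt al]]|[/eqP -> mk]].
  set t := [seq val i | i <- enum S] in srt al *.
  have tk : size t = #|S| by rewrite size_map cardE.
  case: {-1}t (erefl t) => [|x u] //= tE /and3P [/eqP x1 /eqP lst pth] /eqP Sk.
  rewrite {}x1 in tE lst pth.
  have uk : size u = k.-1 by rewrite -Sk -tk tE.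
  have pth' : path (fun a b => a < b <= a + D) 1 u.
    move: srt; rewrite tE /=; elim: (u) (1) pth => //= z v IH y /andP [yz pv] /andP [lt pl].
    rewrite IH // lt /=; move: yz; rewrite mem_filter mem_iota; lia.
  (* The [k - 1] gaps are at most [D] and add up to [(k - 1) * D], so each of them equals [D]. *)
  have [_] := path_max_step pth'; rewrite lst lastE uk => /(_ erefl) uE.
  have ts0 : t = s0 by rewrite tE uE s0E.
  rewrite -markE -ts0 al; split=> //; apply/eqP/setP => i; rewrite inE.
  by rewrite mem_map ?mem_enum //; exact: val_inj.
rewrite cardE -(size_map val) /is_cluster enum0 markE mk /s0 size_map size_iota eqxx.
split=> //; rewrite -/s0 s0E; apply/and3P; split=> //.
  rewrite -s0E -enum0; exact: sorted_val_enum.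
rewrite eqxx lastE /=; apply/andP; split.
  rewrite (last_map (fun j => 1 + j * D) _ 0).
  by case: k.-1 => // j; rewrite -(addn1 j) iotaD last_cat /= add1n addn1.
have : D \in Ov p by rewrite -Dn max_Ov.
move=> DO; apply/(pathP 0) => i; rewrite size_map size_iota => ik.
rewrite -s0E /s0 !(nth_map 0) ?size_iota ?nth_iota //; try lia.
by rewrite (_ : _ - _ = D) //; lia.
Qed.

Lemma r_tight p k : 1 < size p -> 0 < k ->
  r p (1 + k * (size p - 1)) k = num_marked p (tight (size p - 1) 0 k).
Proof.
move=> p1 k0; rewrite /num_marked size_tight ?subn_gt0 // add0n [k * _ + 1]addnC countE /r.
rewrite big_seq [RHS]big_seq; apply: eq_bigr => s /perms_size sn.
pose S0 := [set i : 'I_(1 + k * (size p - 1)).+1 |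
  val i \in [seq 1 + j * (size p - 1) | j <- iota 0 k]].
(* For each [s] the only candidate for the set of marks is [S0]. *)
transitivity #|if marked p s (tight (size p - 1) 0 k) then [set S0] else set0|.
  congr (#|pred_of_set _|); apply/setP => S; rewrite inE is_cluster_tight // -/S0.
  by case: (marked _ _ _); rewrite ?andbT ?andbF !inE.
by case: (marked _ _ _); rewrite ?cards1 ?cards0.
Qed.

(** * Upper bound: the spine is increasing, so the other values determine the permutation *)

Lemma occ_lt p s g i j : occ p (drop g s) -> i < size p -> j < size p ->
  (nth 0 s (g + i) < nth 0 s (g + j)) = (nth 0 p i < nth 0 p j).
Proof.
move=> o ip jp; have ps := occ_size o; move/eqP: o => <-.
have sw : size (take (size p) (drop g s)) = size p by rewrite size_takel.
rewrite /st !(nth_map 0) ?sw // rank_mono ?mem_nth ?sw //.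
by rewrite !nth_take // !nth_drop.
Qed.

Lemma index_perms n p x : p \in perms n -> 0 < x <= n ->
  (index x p < n) * (nth 0 p (index x p) = x).
Proof.
move=> pP xn; have xp : x \in p.
  by move: pP; rewrite mem_perms => /perm_mem ->; rewrite mem_iota add1n ltnS.
by rewrite nth_index // -{1}(perms_size pP) index_mem.
Qed.

Lemma nth_perms n p i : p \in perms n -> i < n -> 0 < nth 0 p i <= n.
Proof.
move=> pP ni; have : nth 0 p i \in p by rewrite mem_nth ?(perms_size pP).
by move: pP; rewrite mem_perms => /perm_mem ->; rewrite mem_iota add1n ltnS.
Qed.

(* Position of the [t]-th element of the chain formed by the ranks between the
   first and the last letter of [p] in consecutive windows. *)
Definition spine D (p : seq nat) t :=
  let d := nth 0 p D - nth 0 p 0 in t %/ d * D + index (nth 0 p 0 + t %% d) p.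

(** The case [x = d] is the gluing: the last letter of window [j] is the first letter of window
    [j + 1]. *)
Lemma spineE D p j x (d := nth 0 p D - nth 0 p 0) :
  p \in perms D.+1 -> nth 0 p 0 < nth 0 p D -> x <= d ->
  spine D p (j * d + x) = j * D + index (nth 0 p 0 + x) p.
Proof.
move=> pP ab; have d0 : 0 < d by rewrite subn_gt0.
have up := perms_uniqE pP; have sp := perms_size pP.
rewrite /spine -/d leq_eqVlt => /orP [/eqP ->|xd].
  rewrite -mulSnr mulnK // modnMl addn0 subnKC 1?ltnW //.
  by rewrite !index_uniq ?sp // addn0 mulSnr.
by rewrite divnMDl // divn_small // modnMDl modn_small // addn0.
Qed.

Lemma spine_lt D p s k t : p \in perms D.+1 -> nth 0 p 0 < nth 0 p D ->
  (forall j, j < k -> occ p (drop (j * D) s)) ->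
  t < k * (nth 0 p D - nth 0 p 0) ->
  nth 0 s (spine D p t) < nth 0 s (spine D p t.+1).
Proof.
move=> pP ab os; set d := _ - _ => tk; have d0 : 0 < d by rewrite subn_gt0.
have jk : t %/ d < k by rewrite ltn_divLR.
have xd := ltn_pmod t d0.
have /andP [a0 aD] := nth_perms pP (ltn0Sn D).
have /andP [b0 bD] := nth_perms pP (ltnSn D).
have I1 : 0 < nth 0 p 0 + t %% d <= D.+1 by rewrite /d in xd *; lia.
have I2 : 0 < nth 0 p 0 + (t %% d).+1 <= D.+1 by rewrite /d in xd *; lia.
rewrite {1 2}(divn_eq t d) -addnS !spineE ?(ltnW xd) //.
rewrite (occ_lt (os _ jk)) ?(perms_size pP) ?(index_perms pP I1) ?(index_perms pP I2) //.
by rewrite addnS.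
Qed.

Lemma spine_bound D p k t : p \in perms D.+1 -> nth 0 p 0 < nth 0 p D ->
  t <= k * (nth 0 p D - nth 0 p 0) -> spine D p t < 1 + k * D.
Proof.
move=> pP ab; set d := _ - _; have d0 : 0 < d by rewrite subn_gt0.
rewrite leq_eqVlt => /orP [/eqP ->|tk].
  rewrite -[k * d]addn0 spineE // addn0.
  by rewrite index_uniq ?(perms_size pP) ?(perms_uniqE pP) // addn0.
have jk : t %/ d < k by rewrite ltn_divLR.
have xd := ltn_pmod t d0.
have /andP [a0 aD] := nth_perms pP (ltn0Sn D).
have /andP [b0 bD] := nth_perms pP (ltnSn D).
have I1 : 0 < nth 0 p 0 + t %% d <= D.+1 by rewrite /d in xd *; lia.
have [iD _] := index_perms pP I1.
rewrite /spine -/d; have : (t %/ d).+1 * D <= k * D by rewrite leq_mul2r jk orbT.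
rewrite mulSnr; lia.
Qed.

Lemma num_marked_upper D p k (d := nth 0 p D - nth 0 p 0) :
  p \in perms D.+1 -> nth 0 p 0 < nth 0 p D ->
  num_marked p (tight D 0 k) <= (2 + k * D) ^ (k * (D - d)).
Proof.
move=> pP ab.
have /andP [a0 aD] := nth_perms pP (ltn0Sn D).
have /andP [b0 bD] := nth_perms pP (ltnSn D).
have dD : d <= D by rewrite /d; lia.
have D0 : 0 < D by case: (D) ab; rewrite ?ltnn.
rewrite /num_marked size_tight // add0n addnC; set n := 1 + k * D.
pose T := [seq spine D p t | t <- iota 0 (k * d).+1].
have srt s : marked p s (tight D 0 k) -> sorted ltn [seq nth 0 s q | q <- T].
  move=> /(marked_tightP _ _ _ D0) os; apply/(sortedP 0) => i.
  rewrite -map_comp size_map size_iota => ik.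
  rewrite !(nth_map 0) ?size_iota ?(ltnW ik) // !nth_iota ?(ltnW ik) //; exact: (spine_lt pP ab os).
rewrite -size_filter; set V := [seq s <- _ | _].
(* If [V] is empty, the bound is trivial. Otherwise [s1] is strictly increasing along [T], which
   shows that the positions in [T] are distinct. *)
case VE : V => [|s1 V'] //; rewrite -VE.
have uT : uniq T.
  have : s1 \in V by rewrite VE mem_head.
  rewrite mem_filter => /andP [/srt /(sorted_uniq ltn_trans ltnn) + _].
  exact: map_uniq.
pose U := [seq q <- iota 0 n | q \notin T].
have TU : perm_eq (T ++ U) (iota 0 n).
  rewrite perm_sym -(perm_filterC (mem T)) perm_sym perm_cat2r.
  apply: uniq_perm => // [|q]; first by rewrite filter_uniq ?iota_uniq.
  rewrite mem_filter mem_iota; apply/idP/andP => [qT|[]//]; split=> //.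
  case/mapP: qT => t; rewrite mem_iota => tk ->; apply: spine_bound => //.
have sU : size U = k * (D - d).
  have := perm_size TU; rewrite size_cat size_map !size_iota mulnBr /n.
  have : k * d <= k * D by rewrite leq_mul2l dD orbT.
  lia.
(* Values lie in [1..n], hence fit into ['I_n.+1]; its cardinality is the base [2 + k * D]. *)
pose g (s : seq nat) := [ffun i : 'I_(k * (D - d)) => inord (nth 0 s (nth 0 U i)) : 'I_n.+1].
have gi : {in V &, injective g}.
  move=> s t; rewrite !mem_filter => /andP [sM sP] /andP [tM tP] gst.
  have ss := perms_size sP; have ts := perms_size tP.
  have eqU : {in U, nth 0 s =1 nth 0 t}.
    move=> q qU; have iU : index q U < k * (D - d) by rewrite -sU index_mem.
    have /ffunP /(_ (Ordinal iU)) := gst; rewrite !ffunE /= nth_index //.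
    move: qU; rewrite mem_filter mem_iota add0n => /andP [_ qn].
    have /andP [_ h1] := nth_perms sP qn; have /andP [_ h2] := nth_perms tP qn.
    by move/(congr1 (@nat_of_ord _)); rewrite !inordK.
  have pst : perm_eq [seq nth 0 s q | q <- T ++ U] [seq nth 0 t q | q <- T ++ U].
    have E u : u \in perms n -> perm_eq [seq nth 0 u q | q <- T ++ U] (iota 1 n).
      move=> uP; apply: (perm_trans (perm_map _ TU)).
      rewrite -{1}(perms_size uP) -/(mkseq _ _) mkseq_nth; by rewrite -mem_perms.
    by apply: (perm_trans (E _ sP)); rewrite perm_sym E.
  (* Agreement on [U] leaves the same values for [T], and these must appear in increasing order. *)
  have eqT : {in T, nth 0 s =1 nth 0 t}.
    apply/eq_in_map/(irr_sorted_eq ltn_trans ltnn); [exact: srt | exact: srt |].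
    apply: perm_mem; move: pst; rewrite !map_cat.
    by rewrite (proj1 (eq_in_map _ _ _) eqU) perm_cat2r.
  apply: (@eq_from_nth _ 0) => [|q]; first by rewrite ss.
  rewrite ss => qn; have : q \in T ++ U by rewrite (perm_mem TU) mem_iota.
  by rewrite mem_cat => /orP [/eqT|/eqU].
have uV : uniq (map g V) by rewrite map_inj_in_uniq // filter_uniq ?permutations_uniq.
rewrite -(size_map g) -(card_uniqP uV); apply: leq_trans (max_card _) _.
by rewrite card_ffun !card_ord.
Qed.

(** * Lower bound: permutations with the spine values in one block *)

(* [layer a d k R j y] is the value, counted from 0, of the element of rank [y]
   in window [j]: the non-spine elements of equal rank in the [k] windows form
   a block, arranged by [R], and the spine forms one block in the middle. *)
Definition layer (a d k : nat) (R : nat -> nat -> nat) (j y : nat) : nat :=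
  if y < a then y * k + R y j
  else if y <= a + d then a * k + j * d + (y - a)
  else k * d + 1 + (y - d.+1) * k + R (y - d.+1) j.

Lemma euclid_inj k y r y' r' : r < k -> r' < k ->
  y * k + r = y' * k + r' -> y = y' /\ r = r'.
Proof.
move=> rk rk' e; have k0 : 0 < k by apply: leq_ltn_trans rk.
have := congr1 (divn^~ k) e; rewrite /= !divnMDl // !divn_small // !addn0 => ey.
by split=> //; move: e; rewrite ey => /addnI.
Qed.

Lemma layer_mono D a d k R j y y' : a + d <= D -> j < k ->
  (forall t i, t < D - d -> i < k -> R t i < k) ->
  y < y' <= D -> layer a d k R j y < layer a d k R j y'.
Proof.
move=> adD jk Rk; have step x : x < D -> layer a d k R j x < layer a d k R j x.+1.
  move=> xD; rewrite /layer.
  have jd : j * d + d <= k * d by rewrite -mulSnr leq_mul2r jk orbT.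
  case: (ltnP x.+1 a) => h1.
    rewrite (ltnW h1) mulSnr; have : R x j < k by apply: Rk => //; lia.
    lia.
  case: (ltnP x a) => h2.
    have -> : a = x.+1 by lia.
    rewrite leq_addr mulSnr; have : R x j < k by apply: Rk => //; lia.
    lia.
  case: (leqP x.+1 (a + d)) => h3; first by rewrite (ltnW h3); lia.
  case: (leqP x (a + d)) => h4.
    have -> : x = a + d by lia.
    by rewrite subSS !addKn addnK; lia.
  have -> : x.+1 - d.+1 = (x - d.+1).+1 by lia.
  rewrite mulSnr; have : R (x - d.+1) j < k by apply: Rk => //; lia.
  lia.
elim: y' => // y' IH /andP [yy yD]; move: yy; rewrite ltnS leq_eqVlt.
case/orP => [/eqP ->|yy]; first exact: step.
by apply: ltn_trans (step _ yD); apply: IH; rewrite yy ltnW.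
Qed.

(** A shared position is read as the first letter of the later window, and the last position as the
    first letter of a fictitious window [k]. Both readings agree, since [j * d + d = j.+1 * d] on
    the spine. *)
Definition layer_word D (p : seq nat) k R : seq nat :=
  mkseq (fun g => (layer (nth 0 p 0).-1 (nth 0 p D - nth 0 p 0) k R
                     (g %/ D) (nth 0 p (g %% D)).-1).+1) (1 + k * D).

Lemma nth_layer_word D p k R j i (a := (nth 0 p 0).-1) (d := nth 0 p D - nth 0 p 0) :
  p \in perms D.+1 -> nth 0 p 0 < nth 0 p D -> j < k -> i <= D ->
  nth 0 (layer_word D p k R) (j * D + i) = (layer a d k R j (nth 0 p i).-1).+1.
Proof.
move=> pP ab jk iD.
have D0 : 0 < D by case: (D) ab; rewrite ?ltnn.
have /andP [a0 _] := nth_perms pP (ltn0Sn D).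
have jD : (j.+1 * D) <= k * D by rewrite leq_mul2r jk orbT.
rewrite nth_mkseq; last by rewrite mulSnr in jD; lia.
move: iD; rewrite leq_eqVlt => /orP [/eqP ->|iD]; last first.
  by rewrite divnMDl // divn_small // modnMDl modn_small // addn0.
rewrite -mulSnr mulnK // modnMl -/a -/d /layer; congr S.
have -> : (nth 0 p D).-1 = a + d by rewrite /a /d; lia.
rewrite ltnn leq_addr leqnn subnn addn0 ltnNge leq_addr /= addKn; lia.
Qed.

(** By [layer_mono] the window is the image of [p] under a map increasing on its letters. *)
Lemma layer_word_occ D p k R j (d := nth 0 p D - nth 0 p 0) :
  p \in perms D.+1 -> nth 0 p 0 < nth 0 p D -> j < k ->
  (forall t i, t < D - d -> i < k -> R t i < k) ->
  occ p (drop (j * D) (layer_word D p k R)).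
Proof.
move=> pP ab jk Rk; have sp := perms_size pP.
have /andP [a0 _] := nth_perms pP (ltn0Sn D).
have /andP [_ bD] := nth_perms pP (ltnSn D).
have jD : (j.+1 * D) <= k * D by rewrite leq_mul2r jk orbT.
pose f y := (layer (nth 0 p 0).-1 d k R j y.-1).+1.
have E : take (size p) (drop (j * D) (layer_word D p k R)) = map f p.
  have sz : size (drop (j * D) (layer_word D p k R)) = 1 + k * D - j * D.
    by rewrite size_drop size_mkseq.
  have sz' : size p <= 1 + k * D - j * D by rewrite sp; rewrite mulSnr in jD; lia.
  apply: (@eq_from_nth _ 0); rewrite ?size_map size_takel ?sz // => i ip.
  by rewrite nth_take // nth_drop nth_layer_word ?(nth_map 0) // -ltnS -sp.
have fm x y : x \in p -> y \in p -> x < y -> f x < f y.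
  move: (pP); rewrite mem_perms => /perm_mem pE; rewrite !pE !mem_iota => hx hy xy.
  by rewrite /f ltnS; apply: (@layer_mono D) => //; rewrite /d; lia.
rewrite /occ E st_map ?(st_id pP) // => x y xp yp.
case: (ltngtP x y) => [xy|yx|->]; last by rewrite ltnn.
  by rewrite fm.
by apply/negbTE; rewrite -leqNgt ltnW // fm.
Qed.

Lemma layer_word_perms D p k R (d := nth 0 p D - nth 0 p 0) :
  p \in perms D.+1 -> nth 0 p 0 < nth 0 p D ->
  (forall t i, t < D - d -> i < k -> R t i < k) ->
  (forall t i j, t < D - d -> i < k -> j < k -> R t i = R t j -> i = j) ->
  layer_word D p k R \in perms (1 + k * D).
Proof.
move=> pP ab Rk Ri.
have sp := perms_size pP; have up := perms_uniqE pP.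
have D0 : 0 < D by case: (D) ab; rewrite ?ltnn.
have /andP [a0 _] := nth_perms pP (ltn0Sn D).
have /andP [_ bD] := nth_perms pP (ltnSn D).
set a := (nth 0 p 0).-1; have adb : (nth 0 p D).-1 = a + d by rewrite /a /d; lia.
have adD : a + d <= D by rewrite -adb; lia.
have d0 : 0 < d by rewrite subn_gt0.
have kD : k * D = k * d + k * (D - d) by rewrite -mulnDr subnKC //; lia.
(* Euclidean division never reads a position as the last letter of a window, and it meets window [k]
   only in its first letter. *)
have split_pos g : g < 1 + k * D ->
    [/\ (nth 0 p (g %% D)).-1 <= D, (nth 0 p (g %% D)).-1 != a + d &
        (g %/ D < k \/ g %/ D = k /\ (nth 0 p (g %% D)).-1 = a)].
  move=> gn; have iD := ltn_pmod g D0.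
  have /andP [h1 h2] := nth_perms pP (ltnW iD : g %% D < D.+1); split.
  - lia.
  - rewrite -adb; apply/eqP => e.
    have : nth 0 p (g %% D) = nth 0 p D by lia.
    by move/eqP; rewrite nth_uniq ?sp // 1?ltnW //; lia.
  - have : g %/ D <= k by rewrite -(mulnK k D0) leq_div2r //; lia.
    rewrite leq_eqVlt => /orP [/eqP e|]; [right | by left].
    have := divn_eq g D; rewrite e => ge; have -> : g %% D = 0 by lia.
    by [].
(* The next three bounds put the ranks below, on and above the spine into disjoint intervals of
   values, so collisions need only be excluded within each kind. *)
have low y j : y < a -> j < k -> y * k + R y j < a * k.
  move=> ya jk; have := Rk y j; have : y.+1 * k <= a * k by rewrite leq_mul2r ya orbT.
  rewrite mulSnr => h1 h2; have := h2 _ jk; lia.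
have mid y j : a <= y <= a + d -> y != a + d -> (j < k \/ j = k /\ y = a) ->
    a * k <= a * k + j * d + (y - a) <= a * k + k * d.
  move=> ya yn [jk|[-> ->]]; last lia.
  have : j.+1 * d <= k * d by rewrite leq_mul2r jk orbT.
  rewrite mulSnr; lia.
have high y j : a + d < y -> y <= D -> j < k ->
    a * k + k * d < k * d + 1 + (y - d.+1) * k + R (y - d.+1) j <= k * D.
  move=> ya yD jk; have := Rk (y - d.+1) j.
  have : a * k <= (y - d.+1) * k by rewrite leq_mul2r; lia.
  have : (y - d.+1).+1 * k <= (D - d) * k by rewrite leq_mul2r; lia.
  rewrite mulSnr => h1 h2 h3; have := h3 _ jk; lia.
apply: mem_perms_uniq; rewrite ?size_mkseq //; last first.
  move=> v /mapP [g]; rewrite mem_iota add0n => /split_pos [yD yn jk] ->.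
  rewrite -/a -/d /=.
  move: (g %/ D) (nth 0 p (g %% D)).-1 yD yn jk => j y yD yn jk; rewrite /layer.
  have ak : a * k <= k * (D - d) by rewrite mulnC leq_mul2l; lia.
  case: (ltnP y a) => h1.
    by have := @low y j h1; case: jk => [jk /(_ jk)|[_ e]]; lia.
  case: (leqP y (a + d)) => h2.
    by have := mid y j; rewrite h1 h2 => /(_ isT yn jk); lia.
  by case: jk => [jk|[_ e]]; [have := high y j h2 yD jk|]; lia.
rewrite map_inj_in_uniq ?iota_uniq // => g g'.
rewrite !mem_iota !add0n => /andP [_ /split_pos [yD yn jk]] /andP [_ /split_pos [yD' yn' jk']].
move=> [e].
suff [E1 E2] : g %/ D = g' %/ D /\ (nth 0 p (g %% D)).-1 = (nth 0 p (g' %% D)).-1.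
  rewrite (divn_eq g D) (divn_eq g' D) E1; congr addn.
  have iD := ltn_pmod g D0; have iD' := ltn_pmod g' D0.
  have := nth_perms pP (ltnW iD : g %% D < D.+1).
  have := nth_perms pP (ltnW iD' : g' %% D < D.+1) => h1 h2.
  have E3 : nth 0 p (g %% D) = nth 0 p (g' %% D) by lia.
  by apply/eqP; rewrite -(@nth_uniq _ 0 p) ?sp ?E3 ?ltnS ?(ltnW iD) ?(ltnW iD').
move: e; rewrite -/a -/d.
move: (g %/ D) (nth 0 p (g %% D)).-1 yD yn jk => j y yD yn jk.
move: (g' %/ D) (nth 0 p (g' %% D)).-1 yD' yn' jk' => j' y' yD' yn' jk'; rewrite /layer.
case: (ltnP y a) => h1; case: (ltnP y' a) => h1'.
- case: jk => [jk|]; last lia; case: jk' => [jk'|]; last lia.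
  have yL : y < D - d by lia.
  have yL' : y' < D - d by lia.
  case/euclid_inj; rewrite ?Rk // => yy; rewrite -yy => /Ri; by split=> //; auto.
- case: jk => [jk|]; last lia; have := low _ _ h1 jk.
  case: (leqP y' (a + d)) => h2'.
    by have := mid y' j'; rewrite h1' h2' => /(_ isT yn' jk'); lia.
  by case: jk' => [jk'|]; [have := high _ _ h2' yD' jk'|]; lia.
- case: jk' => [jk'|]; last lia; have := low _ _ h1' jk'.
  case: (leqP y (a + d)) => h2.
    by have := mid y j; rewrite h1 h2 => /(_ isT yn jk); lia.
  by case: jk => [jk|]; [have := high _ _ h2 yD jk|]; lia.
case: (leqP y (a + d)) => h2; case: (leqP y' (a + d)) => h2'.
- rewrite -!addnA => /addnI /euclid_inj [||-> e]; lia.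
- have := mid y j; rewrite h1 h2 => /(_ isT yn jk).
  by case: jk' => [jk'|]; [have := high _ _ h2' yD' jk'|]; lia.
- have := mid y' j'; rewrite h1' h2' => /(_ isT yn' jk').
  by case: jk => [jk|]; [have := high _ _ h2 yD jk|]; lia.
case: jk => [jk|]; last lia; case: jk' => [jk'|]; last lia.
have yL : y - d.+1 < D - d by lia.
have yL' : y' - d.+1 < D - d by lia.
rewrite -!addnA => /addnI /addnI /euclid_inj [||yy]; rewrite ?Rk //.
rewrite -yy => /Ri -> //; lia.
Qed.

Lemma layer_word_inj D p k R R' (d := nth 0 p D - nth 0 p 0) t j :
  p \in perms D.+1 -> nth 0 p 0 < nth 0 p D -> t < D - d -> j < k ->
  layer_word D p k R = layer_word D p k R' -> R t j = R' t j.
Proof.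
move=> pP ab tL jk e.
have /andP [a0 _] := nth_perms pP (ltn0Sn D).
have /andP [_ bD] := nth_perms pP (ltnSn D).
set a := (nth 0 p 0).-1.
(* The rank, counted from 0, of the [t]-th non-spine element: the spine ranks [a..a + d] are
   skipped. *)
pose y := if t < a then t else t + d.+1.
have yD : 0 < y.+1 <= D.+1 by rewrite /y; case: ifP; lia.
have [iD iy] := index_perms pP yD.
have := congr1 (fun w => nth 0 w (j * D + index y.+1 p)) e.
rewrite /= !nth_layer_word // iy /= -/a -/d => -[]; rewrite /layer /y.
case: (ltnP t a) => h; first by rewrite h => /addnI.
have -> : (t + d.+1 < a) = false by lia.
have -> : (t + d.+1 <= a + d) = false by lia.
by rewrite addnK => /addnI.
Qed.

Lemma num_marked_lower D p k (d := nth 0 p D - nth 0 p 0) :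
  p \in perms D.+1 -> nth 0 p 0 < nth 0 p D ->
  k`! ^ (D - d) <= num_marked p (tight D 0 k).
Proof.
move=> pP ab; have D0 : 0 < D by case: (D) ab; rewrite ?ltnn.
(* One permutation of the [k] windows for each non-spine rank; the value 0 is a dummy outside the
   index ranges. *)
pose R (f : {ffun 'I_(D - d) -> 'S_k}) (t j : nat) : nat :=
  if insub t is Some t' then if insub j is Some j' then f t' j' : nat else 0 else 0.
have RE f t j (ht : t < D - d) (hj : j < k) : R f t j = f (Ordinal ht) (Ordinal hj).
  by rewrite /R !insubT.
have Rk f t i : t < D - d -> i < k -> R f t i < k by move=> ht hi; rewrite RE.
have Ri f t i j : t < D - d -> i < k -> j < k -> R f t i = R f t j -> i = j.
  by move=> ht hi hj; rewrite !RE => /val_inj /perm_inj [].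
pose w f := layer_word D p k (R f).
have wi : injective w.
  move=> f f' e; apply/ffunP => -[t ht]; apply/permP => -[j hj].
  by apply/val_inj; rewrite /= -!RE; apply: layer_word_inj e.
rewrite -card_Sn -[D - d]card_ord -card_ffun cardE -(size_map w).
rewrite /num_marked size_tight // add0n addnC -size_filter; apply: uniq_leq_size.
  by rewrite map_inj_uniq ?enum_uniq.
move=> _ /mapP [f _ ->]; rewrite mem_filter (layer_word_perms pP ab (Rk f) (Ri f)).
rewrite andbT; apply/(marked_tightP _ _ _ D0) => j jk; exact: layer_word_occ (Rk f).
Qed.

(** * Comparing the growth of the two bounds *)

Lemma leq_bin_exp2 n m : 'C(n, m) <= 2 ^ n.
Proof.
elim: n m => [|n IH] [|m] //; first by rewrite bin0 expn_gt0.
by rewrite binS expnS mul2n -addnn leq_add.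
Qed.

Lemma leq_exp_ffact x j : x ^ j <= (x + j) ^_ j.
Proof.
elim: j => // j IH; rewrite addnS ffactSS expnS leq_mul //; lia.
Qed.

Lemma leq_expnn_fact k : k ^ k <= 4 ^ k * k`!.
Proof.
apply: leq_trans (leq_exp_ffact k k) _; rewrite -bin_ffact leq_mul2r.
by rewrite (_ : 4 ^ k = 2 ^ (k + k)) ?leq_bin_exp2 ?orbT // addnn -mul2n expnM.
Qed.

(** If it failed, the power [e.+1] of [leq_expnn_fact], divided by [k ^ (k * e)], would give
    [k ^ k <= (4 ^ e.+1 * M ^ e) ^ k]. *)
Lemma exp_lt_fact M e k : 4 ^ e.+1 * M ^ e < k -> (k * M) ^ (k * e) < k`! ^ e.+1.
Proof.
move=> kM; have k0 : 0 < k by apply: leq_ltn_trans kM.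
rewrite ltnNge; apply/negP => H.
have : k ^ (k * e.+1) <= (4 ^ e.+1 * M ^ e) ^ k * k ^ (k * e).
  apply: (@leq_trans ((4 ^ k * k`!) ^ e.+1)); first by rewrite expnM leq_exp2r // leq_expnn_fact.
  rewrite expnMn -expnM; apply: (leq_trans (leq_mul (leqnn _) H)).
  by rewrite !expnMn -!expnM [k * e.+1]mulnC [e * k]mulnC; lia.
rewrite mulnS expnD leq_pmul2r ?expn_gt0 ?k0 // leq_exp2r //; lia.
Qed.

Theorem theorem4p1 (m : nat) (pi tau : seq nat) :
  is_perm m pi -> is_perm m tau ->
  standard_form m pi -> standard_form m tau ->
  nth 0 pi m.-1 - nth 0 pi 0 > nth 0 tau m.-1 - nth 0 tau 0 ->
  (exists K : nat, forall k : nat, K <= k ->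
      r pi (1 + k * (m - 1)) k < r tau (1 + k * (m - 1)) k)
  /\ ~ strongly_cWilf pi tau.
Proof.
case: m => [|D]; first by rewrite /standard_form => _ _ /andP [+ _]; rewrite ltnn.
rewrite /is_perm -!mem_perms => pP tP /andP [pab _] /andP [tab _].
rewrite -[D.+1.-1]/D in pab tab *; rewrite subn1 -[D.+1.-1]/D => dlt.
have D0 : 0 < D by case: (D) pab; rewrite ?ltnn.
have pD : size pi - 1 = D by rewrite (perms_size pP) subn1.
have tD : size tau - 1 = D by rewrite (perms_size tP) subn1.
have p1 : 1 < size pi by rewrite (perms_size pP).
have t1 : 1 < size tau by rewrite (perms_size tP).
set dp := nth 0 pi D - _ in dlt; set dt := nth 0 tau D - _ in dlt.
have dpD : dp <= D.
  by have := nth_perms pP (ltnSn D); have := nth_perms pP (ltn0Sn D); rewrite /dp; lia.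
(* The threshold of [exp_lt_fact] for [M = D + 2], chosen because [2 + k * D <= k * (D + 2)] for
   [k > 0]. *)
set e := D - dp; pose K := (4 ^ e.+1 * (D + 2) ^ e).+1.
have lt k : K <= k ->
    num_marked pi (tight D 0 k) < num_marked tau (tight D 0 k).
  move=> Kk; have k0 : 0 < k by apply: leq_trans Kk.
  apply: leq_ltn_trans (num_marked_upper k pP pab) _.
  apply: leq_trans (num_marked_lower k tP tab).
  (* Here [dt < dp] enters: it makes the exponent [D - dt] at least [e.+1]. *)
  apply: (@leq_trans (k`! ^ e.+1)); last first.
    by rewrite leq_pexp2l ?fact_gt0 // -/dt /e; lia.
  apply: leq_ltn_trans (exp_lt_fact Kk); rewrite -/dp -/e.
  case: (posnP (k * e)) => [->|ke]; first by rewrite !expn0.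
  by rewrite leq_exp2r // mulnDr; lia.
split=> [|w].
  exists K => k Kk; have k0 : 0 < k by apply: leq_trans Kk.
  by have := r_tight p1 k0; have := r_tight t1 k0; rewrite pD tD => -> ->; exact: lt.
(* Equivalence would force equal counts for every [k], contradicting the strict inequality at
   [k = K]. *)
have := lt K (leqnn K); rewrite -{1}pD (strongly_cWilf_tight _ p1 _ w) ?pD ?ltnn //.
by rewrite (perms_size pP) (perms_size tP).
Qed.
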